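(* Fix an integer $k\ge 3$ and suppose that $n$ is a multiple of $k-1$. Let $r=n/(k-1)$, let $\omega=\omega(n)$ be any function tending to infinity with $n$, and let $p=p(n)\in[0,1]$ satisfy $p\ge \omega(\log n)/n^{k-1}$. Then with high probability (as $n\to\infty$ over multiples of $k-1$) $H_{n,p,r}^{(k)}$ contains a rainbow loose Hamilton cycle.
   Context: $H_{n,p,r}^{(k)}$ denotes the randomly colored random $k$-uniform hypergraph on vertex set $[n]=\{1,\dots,n\}$: each $k$-element subset of $[n]$ is included as an edge independently with probability $p$, and each included edge is then independently given a uniformly random color from $[r]$. A loose Hamilton cycle in a $k$-uniform hypergraph $H$ on $n$ vertices ($n$ divisible by $k-1$) is a collection of $n/(k-1)$ edges of $H$ such that, for some cyclic ordering of the $n$ vertices, every edge consists of $k$ consecutive vertices and every pair of consecutive edges (in the natural cyclic ordering of the edges) intersects in precisely one vertex. Equivalently, for some permutation $\pi$ of the vertices (indices modulo $n$), the edges are $\{\pi((i-1)(k-1)+j): j\in[k]\}$ for $i\in[n/(k-1)]$. It is rainbow if its edges all have distinct colors. An event $\mathcal{E}_n$ occurs with high probability if $\lim_{n\to\infty}\Pr(\mathcal{E}_n)=1$. Logarithms are natural. *)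

(* Defs.v *)
From HB Require Import structures.
From mathcomp Require Import all_boot all_order all_algebra all_fingroup.
From mathcomp Require Import all_classical all_reals all_analysis.
Import Order.TTheory GRing.Theory Num.Theory.
Import numFieldNormedType.Exports.

Set Implicit Arguments.
Unset Strict Implicit.
Unset Printing Implicit Defensive.

Local Open Scope ring_scope.
Local Open Scope classical_set_scope.

Definition ksubset (k n : nat) : finType := {e : {set 'I_n} | #|e| == k}.

(* [H e = None] when [e] is not an edge of [H], and [H e = Some c] when [e] is
   an edge with color [c]. *)
Definition colored_hypergraph (k n r : nat) : finType :=
  {ffun ksubset k n -> option 'I_r}.

(* [None] on the sets that are not edges, in particular on those whose
   cardinality is not [k]. *)
Definition edge_color (k n r : nat) (H : colored_hypergraph k n r)
    (e : {set 'I_n}) : option 'I_r :=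
  obind (fun e' : ksubset k n => H e') (insub e).

Definition edges (k n r : nat) (H : colored_hypergraph k n r)
    : {set {set 'I_n}} :=
  [set e : {set 'I_n} | edge_color H e != None]%SET.

(* The vertices [s (i(k-1)), ..., s (i(k-1) + k-1)], with arguments taken
   modulo [n]; positions and edge indices both start at 0. *)
Definition loose_edge (k n : nat) (s : 'S_n) (i : nat) : {set 'I_n} :=
  [set s x | x : 'I_n
     & [exists j : 'I_k, x == (i * k.-1 + j) %% n :> nat]%N]%SET.

Definition loose_Hamilton_cycle (k n : nat) (C : {set {set 'I_n}}) : bool :=
  [exists s : 'S_n, C == [set loose_edge k s i | i : 'I_(n %/ k.-1)]%SET].

Definition rainbow (k n r : nat) (H : colored_hypergraph k n r)
    (C : {set {set 'I_n}}) : bool :=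
  dinjectiveb (edge_color H) (mem C).

Definition has_rainbow_loose_Hamilton_cycle (k n r : nat)
    (H : colored_hypergraph k n r) : bool :=
  [exists C : {set {set 'I_n}},
     [&& loose_Hamilton_cycle k C, C \subset edges H & rainbow H C]].

(* The law of the state of one k-subset: absent with probability [1 - p], and
   present with any given one of the [r] colors with probability [p * (1 / r)]. *)
Definition state_prob (R : realType) (r : nat) (p : R) (o : option 'I_r) : R :=
  if o is Some _ then p / r%:R else 1 - p.

(* The states of the k-subsets are independent, hence the product. *)
Definition hypergraph_prob (R : realType) (k n r : nat) (p : R)
    (H : colored_hypergraph k n r) : R :=
  \prod_(e : ksubset k n) state_prob p (H e).

Definition Pr (R : realType) (k n r : nat) (p : R)
    (E : pred (colored_hypergraph k n r)) : R :=
  \sum_(H : colored_hypergraph k n r | E H) hypergraph_prob p H.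

Definition positive_multiples (d : nat) : set nat :=
  [set n | (0 < n)%N /\ (d %| n)%N].

(* Main.v *)
Require Import Defs.
From HB Require Import structures.
From mathcomp Require Import all_boot all_order all_algebra all_fingroup.
From mathcomp Require Import ring lra zify.
Import Order.TTheory GRing.Theory Num.Theory.

(* A rainbow loose Hamilton cycle is a set of n/(k-1) pairs (edge, color), and
   the random hypergraph is a random set of pairs, at most one per k-subset. The
   cycles considered below are given by a cyclic permutation and k-1 arbitrary
   permutations of r = n/(k-1) points, whence a uniform member contains a given
   set of s pairs with probability at most (C / n^k)^s: the family is spread.

   Spread families are hit by the fragment argument of Frankston, Kahn,
   Narayanan and Park. Expose the random set in about log n rounds; a member A
   leaves the fragment A' \ W, with A' \ W contained in A and as small as
   possible. The union of W and the fragment determines a member that contains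
   the fragment, so few fragments are possible for each union, and spreadness
   makes all but a small proportion of the members shrink by half in each round.
   Members that fail to shrink are dropped, without renormalizing. Rounds are
   merged by McDiarmid's coordinatewise comparison. *)

Set Implicit Arguments.
Unset Strict Implicit.
Unset Printing Implicit Defensive.

Lemma leq_card_bigcup (I T : finType) (P : pred I) (F : I -> {set T}) :
  #|\bigcup_(i | P i) F i| <= \sum_(i | P i) #|F i|.
Proof.
apply: (big_ind2 (fun (X : {set T}) n => #|X| <= n)) => [|X n Y m ? ?|//].
  by rewrite cards0.
by apply: leq_trans (leq_add _ _); first exact: leq_card_setU.
Qed.

(** * Cyclic permutations *)

Section CyclicPerm.
Variable (T : finType).
Implicit Types (U D : {set T}) (s : {perm T}) (a b x : T).

(* One orbit on [U] and fixed points elsewhere, expressed by the number of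
   orbits, which [porbits_mul_tperm] tracks. *)
Definition cyclic_on U : {set {perm T}} :=
  [set s | perm_on U s & #|porbits s| + #|U| == #|T|.+1].

Lemma porbit_out s U x : perm_on U s -> x \notin U -> porbit s x = [set x].
Proof.
move=> sU xU; apply/setP => y; rewrite inE; apply/porbitP/eqP => [[i ->]|->].
  by rewrite permX; elim: i => //= i ->; exact: out_perm sU xU.
by exists 0; rewrite expg0 perm1.
Qed.

(** Points outside [U] are singleton orbits, and any point of [U] lies in a further one. Equality
    says that [U] is a single orbit, which is the condition in [cyclic_on]. *)
Lemma porbits_card_ge s U : perm_on U s -> U != set0 ->
  #|T|.+1 <= #|porbits s| + #|U|.
Proof.
move=> sU /set0Pn[u uU]; pose D := u |: ~: U.
have inj : {in D &, injective (porbit s)}.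
  have out x y : x \notin U -> porbit s x = porbit s y -> x = y.
    move=> xU xy; have := porbit_id s y.
    by rewrite -xy (porbit_out sU xU) inE => /eqP ->.
  move=> x y; rewrite !inE => /orP[/eqP ->|xU] /orP[/eqP ->|yU] // xy.
  - by rewrite (out _ _ yU (esym xy)).
  - exact: out xy.
  - exact: out xy.
have sub : porbit s @: D \subset porbits s.
  by apply/subsetP => _ /imsetP[x _ ->]; apply: imset_f.
have := subset_leq_card sub; have := cardsC U.
by rewrite card_in_imset // cardsU1 inE uU /=; lia.
Qed.

(** If [a] were fixed, [s] would be supported on the smaller set [U :\ a] and would have one orbit
    too many. *)
Lemma cyclic_on_neq s U a : s \in cyclic_on U -> a \in U -> 1 < #|U| ->
  s a != a.
Proof.
rewrite inE => /andP[sU /eqP card_s] aU U1; apply/eqP => sa.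
have sU' : perm_on (U :\ a) s.
  apply/subsetP => x; rewrite !inE => sx; have := subsetP sU x sx => ->.
  by rewrite andbT; apply: contra sx => /eqP ->; rewrite sa.
have U'0 : U :\ a != set0.
  by rewrite -card_gt0; move: U1; rewrite (cardsD1 a) aU; lia.
have := porbits_card_ge sU' U'0; move: card_s; rewrite (cardsD1 a U) aU; lia.
Qed.

(** Composing with the transposition cuts [b] out of the cycle: [a] now goes to [s b], [b] becomes a
    fixed point, and the number of orbits grows by one. *)
Lemma cyclic_on_contract s U a b : s \in cyclic_on U -> b \in U ->
  s a = b -> a != b -> (tperm a b * s)%g \in cyclic_on (U :\ b).
Proof.
rewrite !inE => /andP[sU /eqP card_s] bU sab ab; apply/andP; split.
  apply/subsetP => x; rewrite !inE permM; case: tpermP => [->|->|_ /eqP xb] sx.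
  - by rewrite ab -(perm_closed _ sU) sab.
  - by move: sx; rewrite sab eqxx.
  - by rewrite xb (subsetP sU x sx).
have := porbits_mul_tperm s a b; rewrite porbit_sym.
have -> : b \in porbit s a by rewrite -sab; have := mem_porbit s 1 a; rewrite expg1.
rewrite ab /=; move: card_s; rewrite (cardsD1 b U) bU => <- h; apply/eqP. 
by rewrite addn0 in h; rewrite h -addnA.
Qed.

(** The inverse operation: the singleton orbit [b] is inserted right after [a]. *)
Lemma cyclic_on_extend s U a b : s \in cyclic_on (U :\ b) -> a \in U ->
  b \in U -> a != b -> (tperm a b * s)%g \in cyclic_on U.
Proof.
rewrite !inE => /andP[sU /eqP card_s] aU bU ab; apply/andP; split.
  apply: perm_onM; last by apply: subset_trans sU (subsetDl _ _).
  by apply: subset_trans (tperm_on a b) _; rewrite subUset !sub1set aU bU.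
have := porbits_mul_tperm s a b.
have -> : a \notin porbit s b.
  by rewrite (porbit_out sU) ?inE ?eqxx // ab.
rewrite ab /=; move: card_s; rewrite (cardsD1 b U) bU => <- h; apply/eqP.
by move: h; move: #|porbits _| #|porbits _| => x y; lia.
Qed.

(** Fix [a] in [U]. Its image [b] may be any other point, and [cyclic_on_extend] turns each cyclic
    permutation of [U :\ b] injectively into one of [U] that sends [a] to [b]. *)
Lemma card_cyclic_on_ge m U : #|U| = m.+1 -> m`! <= #|cyclic_on U|.
Proof.
elim: m U => [|m IH] U Um.
  rewrite card_gt0; apply/set0Pn; exists 1%g; rewrite inE perm_on1 /=.
  have U0 : U != set0 by rewrite -card_gt0 Um.
  have := porbits_card_ge (perm_on1 U) U0; rewrite Um !addn1 ltnS eqSS eqn_leq => ->.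
  by rewrite andbT leq_imset_card.
have [a aU] : exists a, a \in U by apply/card_gt0P; rewrite Um.
rewrite -[leqRHS]sum1_card (partition_big (fun s : {perm T} => s a) predT) //=.
apply: (@leq_trans (\sum_(b in U :\ a) #|cyclic_on (U :\ b)|)).
  have Ua : #|U :\ a| = m.+1 by move: Um; rewrite (cardsD1 a) aU => -[].
  rewrite factS -Ua -sum_nat_const; apply: leq_sum => b /setD1P[_ bU].
  by apply: IH; move: Um; rewrite (cardsD1 b) bU => -[].
rewrite [leqRHS](bigID (mem (U :\ a))) /=; apply: leq_trans (leq_addr _ _).
apply: leq_sum => b /setD1P[ba bU]; rewrite sum1_card.
rewrite -[leqLHS](card_imset _ (mulgI (tperm a b))); apply: subset_leq_card.
apply/subsetP => _/imsetP[s sU ->]; rewrite unfold_in /=.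
rewrite cyclic_on_extend // 1?eq_sym //= permM tpermL.
have sUb : perm_on (U :\ b) s by move: sU; rewrite inE => /andP[].
by rewrite (out_perm sUb) // !inE eqxx.
Qed.

(** Each prescribed value is contracted away, at the cost of one point of [U] and one constraint.
    Truncated subtraction covers [D = U], where at most one permutation remains. *)
Lemma card_cyclic_on_agree m U D (g : T -> T) : #|U| = m.+1 -> D \subset U ->
  #|[set s in cyclic_on U | [forall x in D, s x == g x]]| <= (m - #|D|)`!.
Proof.
elim: m U D g => [|m IH] U D g Um DU.
  rewrite sub0n; apply: (@leq_trans #|[set 1%g : {perm T}]|); last by rewrite cards1.
  apply: subset_leq_card; apply/subsetP => s; rewrite !inE => /andP[/andP[sU _] _].
  by apply/eqP; apply: perm_on_id sU _; rewrite Um.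
have contract a b D' (g' : T -> T) : a \in U -> b \in U -> a != b ->
    D' \subset U :\ b ->
    (forall s, s \in cyclic_on U -> s a = b -> {in D, s =1 g} ->
       {in D', (tperm a b * s)%g =1 g'}) ->
    #|[set s in cyclic_on U | (s a == b) && [forall x in D, s x == g x]]| <=
      (m - #|D'|)`!.
  move=> aU bU ab D'U Hg; have Ub : #|U :\ b| = m.+1.
    by move: Um; rewrite (cardsD1 b) bU => -[].
  apply: leq_trans (IH _ D' g' Ub D'U).
  rewrite -(card_imset _ (mulgI (tperm a b))); apply: subset_leq_card.
  apply/subsetP => _ /imsetP[s + ->]; rewrite inE => /and3P[sU /eqP sab /forall_inP sg].
  rewrite inE cyclic_on_contract //=; apply/forall_inP => x xD'.
  by apply/eqP; apply: (Hg s sU sab) => // y yD; apply/eqP/sg.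
(* Without constraints, an arbitrary point has [m.+1] possible images, and each of them is
   contracted. *)
have [D0|[a aD]] := set_0Vmem D.
  have [a aU] : exists a, a \in U by apply/card_gt0P; rewrite Um.
  have Ua : #|U :\ a| = m.+1 by move: Um; rewrite (cardsD1 a) aU => -[].
  rewrite D0 cards0 subn0 factS -Ua -sum_nat_const.
  apply: (@leq_trans (\sum_(b in U :\ a)
    #|[set s in cyclic_on U | (s a == b) && [forall x in D, s x == g x]]|)).
    rewrite -sum1_card (partition_big (fun s : {perm T} => s a) (mem (U :\ a))) /=.
      apply: leq_sum => b bU; rewrite sum1_card subset_leq_card //.
      apply/subsetP => s; rewrite unfold_in /= !inE.
      by rewrite D0 -!andbA => /and4P[-> -> _ ->]; apply/forall_inP => x; rewrite inE.
    move=> s; rewrite inE => /andP[sU _]; rewrite !inE (cyclic_on_neq sU aU) ?Um //=.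
    by move: sU; rewrite inE => /andP[sU _]; rewrite (perm_closed _ sU).
  apply: leq_sum => b /setD1P[ba bU].
  have := contract a b set0 g; rewrite cards0 subn0; apply => //.
  - by rewrite eq_sym.
  - exact: sub0set.
  - by move=> s _ _ _ x; rewrite inE.
have aU := subsetP DU a aD; have D_gt0 : 0 < #|D| by apply/card_gt0P; exists a.
(* A prescribed fixed point, or a prescribed value outside [U], is met by no cyclic permutation. *)
have [bad|] := boolP ((g a == a) || (g a \notin U)).
  rewrite (_ : [set _ in _ | _] = set0) ?cards0 //; apply/setP => s.
  rewrite !inE; apply/negP => /andP[/[dup] sU /andP[sU' _] /forall_inP/(_ a aD)/eqP sa].
  have : s \in cyclic_on U by rewrite inE.
  move/cyclic_on_neq => /(_ a aU); rewrite Um sa => /(_ isT) ne.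
  by move: bad; rewrite (negbTE ne) /= -sa (perm_closed _ sU') aU.
rewrite negb_or negbK => /andP[ba bU]; set b := g a in ba bU.
have ab : a != b by rewrite eq_sym.
have sub : [set s in cyclic_on U | [forall x in D, s x == g x]] \subset
    [set s in cyclic_on U | (s a == b) && [forall x in D, s x == g x]].
  apply/subsetP => s; rewrite !inE => /andP[-> /[dup] /forall_inP/(_ a aD) -> ->].
  by [].
apply: leq_trans (subset_leq_card sub) _.
(* If [b] is constrained too, contraction hands its prescribed value to [a], and [b] leaves [D].
   Otherwise the constraint at [a] is used up and the others are untouched. *)
have [bD|bD] := boolP (b \in D).
  have -> : m.+1 - #|D| = m - #|D :\ b| by rewrite (cardsD1 b D) bD.
  apply: (contract a b (D :\ b) (fun x => if x == a then g b else g x)) => //.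
    exact: setSD.
  move=> s sU sab sg x /setD1P[xb xD]; rewrite permM; case: tpermP => [->|xb'|/eqP xa _].
  - by rewrite eqxx sg.
  - by rewrite xb' eqxx in xb.
  - by rewrite (negbTE xa) sg.
have -> : m.+1 - #|D| = m - #|D :\ a| by rewrite (cardsD1 a D) aD.
apply: (contract a b (D :\ a) g) => //.
  apply/subsetP => x /setD1P[xa xD]; rewrite inE (subsetP DU) // andbT inE.
  by apply: contraNneq bD => <-.
move=> s sU sab sg x /setD1P[xa xD]; rewrite permM tpermD ?sg // eq_sym //.
by apply: contraNneq bD => <-.
Qed.

(** Composed with the inverse of one solution [s0], every solution fixes [D] pointwise and hence is
    a permutation of the complement. *)
Lemma card_perm_agree D (g : T -> T) :
  #|[set s : {perm T} | [forall x in D, s x == g x]]| <= (#|T| - #|D|)`!.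
Proof.
set X := [set s | _]; have [->|[s0 s0X]] := set_0Vmem X; first by rewrite cards0.
have -> : #|T| - #|D| = #|~: D| by rewrite -(cardsC D) addKn.
rewrite -(card_imset _ (mulIg s0^-1%g)) -card_perm.
apply: subset_leq_card; apply/subsetP => _ /imsetP[s sX ->].
apply/subsetP => x; rewrite !inE; apply: contra => xD.
move: sX s0X; rewrite !inE => /forall_inP/(_ x xD)/eqP sx /forall_inP/(_ x xD)/eqP s0x.
by rewrite permM sx -s0x permK.
Qed.

(** Union bound over the subset of [D] on which the first option is taken. *)
Lemma card_perm_options D (g1 g2 : T -> T) :
  #|[set s : {perm T} | [forall x in D, (s x == g1 x) || (s x == g2 x)]]| <=
  2 ^ #|D| * (#|T| - #|D|)`!.
Proof.
rewrite -card_powerset -sum_nat_const.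
apply: (@leq_trans (\sum_(B in powerset D) #|[set s : {perm T} |
   [forall x in D, s x == if x \in B then g1 x else g2 x]]|)); last first.
  by apply: leq_sum => B _; apply: card_perm_agree.
apply: (@leq_trans #|\bigcup_(B in powerset D) [set s : {perm T} |
   [forall x in D, s x == if x \in B then g1 x else g2 x]]|).
  apply: subset_leq_card; apply/subsetP => s; rewrite inE => /forall_inP sx.
  apply/bigcupP; exists [set x in D | s x == g1 x].
    by rewrite inE; apply/subsetP => x; rewrite inE => /andP[].
  rewrite inE; apply/forall_inP => x xD; rewrite inE xD /=.
  by have := sx x xD; case: (boolP (s x == g1 x)).
exact: leq_card_bigcup.
Qed.

End CyclicPerm.

(** * The family of rainbow cycles *)

Section CycleFamily.
Variables (d r : nat).

Lemma vertex_subproof (j : 'I_d) (i : 'I_r) : i * d + j < r * d.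
Proof. have := ltn_ord i; have := ltn_ord j; nia. Qed.

Definition vertex (j : 'I_d) (i : 'I_r) : 'I_(r * d) :=
  Ordinal (vertex_subproof j i).

Lemma vertex_inj j i j' i' : vertex j i = vertex j' i' -> j = j' /\ i = i'.
Proof.
move=> /(congr1 val) /= eq_v; have d0 := leq_ltn_trans (leq0n j) (ltn_ord j).
have jE : j = j'.
  by apply: val_inj; have := congr1 (modn^~ d) eq_v; rewrite !modnMDl !modn_small.
split=> //; apply: val_inj; move: eq_v; rewrite /= jE => /addIn/eqP.
by rewrite eqn_pmul2r // => /eqP.
Qed.

Hypotheses (d_gt1 : 1 < d) (r_gt1 : 1 < r).

Let j0 : 'I_d := Ordinal (ltnW d_gt1).

(** Here [d = k - 1]. The first component sends the color of an edge to that of the next edge; the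
    second distributes the vertices of each class over the edges. Several indices may give the same
    cycle, which is harmless because all counts are over indices. *)
Definition cycle_index : finType := ({perm 'I_r} * {ffun 'I_d -> {perm 'I_r}})%type.

Definition cycle_indices : {set cycle_index} :=
  [set w | w.1 \in cyclic_on [set: 'I_r]].

(* The vertex classes are the ranges of the [vertex j]; class [j0] carries the
   vertices shared by consecutive edges, and each edge is named by its color. *)
Definition cycle_edge (w : cycle_index) (i : 'I_r) : {set 'I_(r * d)} :=
  vertex j0 (w.2 j0 (w.1 i)) |: [set vertex j (w.2 j i) | j : 'I_d].

Lemma vertex_in_cycle_edge w i j y : (vertex j y \in cycle_edge w i) =
  (y == w.2 j i) || (j == j0) && (y == w.2 j0 (w.1 i)).
Proof.
rewrite !inE; apply/orP/orP => [[/eqP/vertex_inj[-> ->]|/imsetP[j' _ /vertex_inj[-> ->]]]|].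
- by right; rewrite !eqxx.
- by left.
case=> [/eqP ->|/andP[/eqP -> /eqP ->]]; last by left.
by right; apply: imset_f.
Qed.

(** A class other than [j0] exists as [d > 1]; it has exactly one vertex on each edge, and this
    vertex identifies the edge. *)
Lemma cycle_edge_inj w : injective (cycle_edge w).
Proof.
move=> i i' eq_e; pose j1 : 'I_d := Ordinal d_gt1.
have : vertex j1 (w.2 j1 i) \in cycle_edge w i'.
  by rewrite -eq_e vertex_in_cycle_edge eqxx.
by rewrite vertex_in_cycle_edge /= orbF => /eqP/perm_inj.
Qed.

Lemma cycle_index_neq w i : w \in cycle_indices -> w.1 i != i.
Proof.
by rewrite inE => w1; apply: cyclic_on_neq w1 _ _; rewrite ?inE // cardsT card_ord.
Qed.

Lemma card_cycle_edge w i : w \in cycle_indices -> #|cycle_edge w i| = d.+1.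
Proof.
move=> wJ; rewrite cardsU1 card_imset; last by move=> j j' /vertex_inj[].
rewrite card_ord (_ : _ \notin _) //; apply/negP => /imsetP[j _ /vertex_inj[<-]].
by move/perm_inj/eqP; rewrite (negbTE (cycle_index_neq i wJ)).
Qed.

Definition cycle_member (w : cycle_index) : {set ksubset d.+1 (r * d) * 'I_r} :=
  [set x | val x.1 == cycle_edge w x.2].

Lemma cycle_memberE w x : (x \in cycle_member w) = (val x.1 == cycle_edge w x.2).
Proof. by rewrite inE. Qed.

Lemma cycle_member_snd_inj w : {in cycle_member w &, injective snd}.
Proof.
move=> [e i] [e' i']; rewrite !cycle_memberE /= => /eqP eE /eqP e'E ii'.
by congr pair => //; apply: val_inj; rewrite /= eE e'E ii'.
Qed.

Lemma cycle_member_fst_inj w : {in cycle_member w &, injective fst}.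
Proof.
move=> [e i] [e' i'] xw yw /= ee'; apply: cycle_member_snd_inj (xw) (yw) _ => /=.
move: xw yw; rewrite !cycle_memberE /= => /eqP eE /eqP e'E.
by apply: (@cycle_edge_inj w); rewrite -eE -e'E ee'.
Qed.

Lemma card_cycle_member w : #|cycle_member w| <= r.
Proof.
rewrite -(card_in_imset (@cycle_member_snd_inj w)) -[leqRHS]card_ord.
exact: max_card.
Qed.

Lemma card_cycle_indices_ge : r.-1`! * r`! ^ d <= #|cycle_indices|.
Proof.
have -> : cycle_indices = setX (cyclic_on [set: 'I_r]) [set: {ffun 'I_d -> {perm 'I_r}}].
  by apply/setP => -[s w]; rewrite !inE andbT.
rewrite cardsX leq_mul //; first by apply: card_cyclic_on_ge; rewrite cardsT card_ord; lia.
rewrite cardsT card_ffun card_ord.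
have -> : #|{perm 'I_r}| = #|perm_on [set: 'I_r]|.
  by apply: eq_card => s; rewrite !inE; apply/esym/subsetP => x; rewrite inE.
by rewrite card_perm cardsT card_ord.
Qed.

(** The pairs in [S] fix the edges whose colors lie in [D]. On [D] each class permutation then has
    at most two options per color, two being possible only in class [j0]. Once these permutations
    are chosen, the successor map is determined on [D]. *)
Lemma cycle_indices_spread (S : {set ksubset d.+1 (r * d) * 'I_r}) :
  #|[set w in cycle_indices | S \subset cycle_member w]| <=
  (r.-1 - #|S|)`! * (2 ^ #|S| * (r - #|S|)`!) ^ d.
Proof.
set X := [set w in _ | _]; have [->|[w0 w0X]] := set_0Vmem X; first by rewrite cards0.
move: (w0X); rewrite inE => /andP[w0J Sw0].
pose D := [set x.2 | x in S].
have cardD : #|D| = #|S|.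
  by rewrite card_in_imset //; apply: sub_in2 (@cycle_member_snd_inj w0); apply/subsetP.
have edgeE w i : w \in X -> i \in D -> cycle_edge w i = cycle_edge w0 i.
  rewrite inE => /andP[_ Sw] /imsetP[x xS ->].
  have := subsetP Sw x xS; have := subsetP Sw0 x xS.
  by rewrite !cycle_memberE => /eqP <- /eqP <-.
pose options j := [set s : {perm 'I_r} | [forall i in D,
   (s i == w0.2 j i) || (s i == w0.2 j0 (w0.1 i))]].
have w2_options w : w \in X -> w.2 \in family (fun j => mem (options j)).
  move=> wX; apply/familyP => j; rewrite inE; apply/forall_inP => i iD.
  have : vertex j (w.2 j i) \in cycle_edge w0 i.
    by rewrite -(edgeE w i wX iD) vertex_in_cycle_edge eqxx.
  by rewrite vertex_in_cycle_edge => /orP[->//|/andP[_ ->]]; rewrite orbT.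
rewrite -sum1_card (partition_big (fun w : cycle_index => w.2)
  (fun psi => psi \in family (fun j => mem (options j)))) //=.
apply: (@leq_trans (\sum_(psi in family (fun j => mem (options j))) (r.-1 - #|D|)`!)).
  apply: leq_sum => psi _; rewrite sum1_card.
  (* The known edge [i] has two vertices in class [j0]. As [psi j0] sends [i] to one of them, it
     must send the successor of [i] to the other. *)
  pose g i := (psi j0)^-1%g (if psi j0 i == w0.2 j0 i then w0.2 j0 (w0.1 i)
                             else w0.2 j0 i).
  have cardT : #|[set: 'I_r]| = r.-1.+1 by rewrite cardsT card_ord; lia.
  apply: leq_trans (card_cyclic_on_agree g cardT (subsetT D)).
  rewrite -[leqLHS](@card_in_imset _ _ (fun w : cycle_index => w.1)); last first.
    by move=> [s p] [s' p']; rewrite !unfold_in /= => /andP[_ /eqP ->] /andP[_ /eqP ->] ->.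
  apply: subset_leq_card; apply/subsetP => _ /imsetP[w /andP[wX /eqP wpsi] ->].
  have wJ : w \in cycle_indices by move: wX; rewrite inE => /andP[].
  rewrite inE; move: (wJ); rewrite inE => -> /=; apply/forall_inP => i iD.
  rewrite /g -wpsi; apply/eqP/(@perm_inj _ (w.2 j0)); rewrite permKV.
  have := cycle_index_neq i wJ; rewrite -(inj_eq (@perm_inj _ (w.2 j0))).
  have : vertex j0 (w.2 j0 (w.1 i)) \in cycle_edge w0 i.
    by rewrite -(edgeE w i wX iD) vertex_in_cycle_edge !eqxx orbT.
  have : vertex j0 (w.2 j0 i) \in cycle_edge w0 i.
    by rewrite -(edgeE w i wX iD) vertex_in_cycle_edge !eqxx.
  rewrite !vertex_in_cycle_edge eqxx /=.
  case: eqP => [->|_] /=; last by move=> /eqP -> /orP[/eqP //|->].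
  by move=> _ /orP[->//|/eqP].
rewrite sum_nat_const mulnC cardD leq_mul //.
rewrite -sum1_card (eq_bigr (fun=> \prod_(j < d) 1)); last first.
  by move=> psi _; rewrite prod_nat_const exp1n.
rewrite -(bigA_distr_big_dep (fun j => mem (options j)) (fun _ _ => 1)).
set b := (2 ^ _ * _)%N; apply: (@leq_trans (\prod_(j < d) b)).
  apply: leq_prod => j _; rewrite sum1_card /b -cardD.
  have := card_perm_options D (w0.2 j) (fun i => w0.2 j0 (w0.1 i)).
  by rewrite card_ord.
by rewrite prod_nat_const card_ord.
Qed.

End CycleFamily.

Local Open Scope ring_scope.

(** * Product laws *)

Section ProductLaw.
Variables (R : realFieldType) (E : finType).

Definition prod_law (Y : finType) (v : Y -> R) (z : {ffun E -> Y}) : R :=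
  \prod_e v (z e).

Lemma prod_law_ge0 (Y : finType) (v : Y -> R) z :
  (forall y, 0 <= v y) -> 0 <= prod_law v z.
Proof. by move=> v0; apply: prodr_ge0. Qed.

Lemma sum_prod_law (Y : finType) (v : Y -> R) :
  \sum_y v y = 1 -> \sum_z prod_law v z = 1.
Proof.
move=> v1; rewrite -(bigA_distr_bigA (fun _ => v)) big1 // => e _.
Qed.

Definition update (Y : finType) (z : {ffun E -> Y}) (e : E) (y : Y) :
  {ffun E -> Y} := [ffun e' => if e' == e then y else z e'].

(** By independence the value at [e] may be replaced by a fresh one: the involution [swap] exchanges
    the two and preserves their joint law. *)
Lemma sum_prod_law_resample (Y : finType) (v : Y -> R)
    (F : {ffun E -> Y} -> R) (e : E) :
  \sum_y v y = 1 ->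
  \sum_z prod_law v z * F z =
  \sum_z prod_law v z * \sum_y v y * F (update z e y).
Proof.
move=> v1.
pose rest (z : {ffun E -> Y}) : R := \prod_(e' | e' != e) v (z e').
have lawE z : prod_law v z = v (z e) * rest z by rewrite /prod_law (bigD1 e).
have restE z y : rest (update z e y) = rest z.
  by apply: eq_bigr => e' /negbTE ne; rewrite ffunE ne.
pose swap (zy : {ffun E -> Y} * Y) := (update zy.1 e zy.2, zy.1 e).
have swapK : involutive swap.
  move=> [z y]; rewrite /swap /= ffunE eqxx; congr pair.
  by apply/ffunP => e'; rewrite !ffunE; case: eqP => // ->.
transitivity (\sum_(zy : {ffun E -> Y} * Y)
    v zy.2 * (v (zy.1 e) * rest zy.1 * F zy.1)).
  rewrite -(pair_big xpredT xpredT
    (fun (z : {ffun E -> Y}) y => v y * (v (z e) * rest z * F z))) /=.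
  by apply: eq_bigr => z _; rewrite -mulr_suml v1 mul1r lawE.
rewrite (reindex_inj (inv_inj swapK)) /=.
rewrite -(pair_big xpredT xpredT (fun (z : {ffun E -> Y}) y => v (z e) *
  (v (update z e y e) * rest (update z e y) * F (update z e y)))) /=.
apply: eq_bigr => z _; rewrite mulr_sumr; apply: eq_bigr => y _.
by rewrite restE ffunE eqxx lawE -!mulrA; congr (_ * _); rewrite mulrCA.
Qed.

Lemma sum_prod_law_pair (Y1 Y2 : finType) (v1 : Y1 -> R) (v2 : Y2 -> R)
    (F : {ffun E -> Y1} -> {ffun E -> Y2} -> R) :
  \sum_(z : {ffun E -> Y1 * Y2}) prod_law (fun y => v1 y.1 * v2 y.2) z *
    F [ffun e => (z e).1] [ffun e => (z e).2] =
  \sum_z1 prod_law v1 z1 * \sum_z2 prod_law v2 z2 * F z1 z2.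
Proof.
pose glue (z : {ffun E -> Y1} * {ffun E -> Y2}) : {ffun E -> Y1 * Y2} :=
  [ffun e => (z.1 e, z.2 e)].
pose split (z : {ffun E -> Y1 * Y2}) :=
  ([ffun e => (z e).1], [ffun e => (z e).2]) : {ffun E -> Y1} * {ffun E -> Y2}.
have glueK : cancel glue split.
  by case=> z1 z2; congr pair; apply/ffunP => e; rewrite !ffunE.
have splitK : cancel split glue.
  by move=> z; apply/ffunP => e; rewrite !ffunE -surjective_pairing.
rewrite (reindex_onto glue split) => [|z _]; last exact: splitK.
rewrite (eq_bigl xpredT) => [|z]; last by rewrite glueK eqxx.
rewrite (eq_bigr (fun z : {ffun E -> Y1} * {ffun E -> Y2} =>
    prod_law v1 z.1 * (prod_law v2 z.2 * F z.1 z.2))).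
  rewrite -(pair_big xpredT xpredT
    (fun z1 z2 => prod_law v1 z1 * (prod_law v2 z2 * F z1 z2))) /=.
  by apply: eq_bigr => z1 _; rewrite mulr_sumr.
case=> z1 z2 _; rewrite mulrA; congr (_ * _).
  by rewrite /prod_law -big_split /=; apply: eq_bigr => e _; rewrite ffunE.
by congr F; apply/ffunP => e; rewrite !ffunE.
Qed.

End ProductLaw.

Lemma sum_pair_mul (R : comNzRingType) (Y1 Y2 : finType) (f1 : Y1 -> R)
    (f2 : Y2 -> R) :
  \sum_(y : Y1 * Y2) f1 y.1 * f2 y.2 = (\sum_y f1 y) * (\sum_y f2 y).
Proof.
by rewrite big_distrlr /= pair_bigA.
Qed.

(** * Random partial colorings and the merging of independent rounds *)

Section ColorModel.
Variables (R : realFieldType) (E C : finType).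
Implicit Types (c : {ffun E -> option C}) (W : {set E * C}).

Definition color_law (q : R) (o : option C) : R :=
  if o is Some _ then q else 1 - q * #|C|%:R.

Definition graph c : {set E * C} := [set x | c x.1 == Some x.2].

(** Linearity of this value in [q] is what allows the rates of two layers to be added. *)
Lemma sum_color_law_fun (q : R) (b : option C -> bool) :
  ~~ b None ->
  \sum_o color_law q o * (b o)%:R = q * #|[set x | b (Some x)]|%:R.
Proof.
move=> bN; rewrite (bigD1 None) //= (negbTE bN) mulr0 add0r.
rewrite (reindex_omap Some (fun o => o)) /=; last by case.
rewrite (eq_bigl xpredT); last by move=> x; rewrite eqxx.
rewrite -mulr_sumr -natr_sum -sum1_card; congr (_ * _%:R).
rewrite [RHS]big_mkcond /=; apply: eq_bigr => x _.
by rewrite inE; case: (b _).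
Qed.

Lemma sum_color_law (q : R) : \sum_o color_law q o = 1.
Proof.
rewrite (bigD1 None) //= (reindex_omap Some (fun o => o)) /=; last by case.
rewrite (eq_bigl xpredT); last by move=> x; rewrite eqxx.
by rewrite sumr_const -[q *+ _]mulr_natr subrK.
Qed.

Lemma color_law_ge0 (q : R) o : 0 <= q -> q * #|C|%:R <= 1 -> 0 <= color_law q o.
Proof. by case: o => //= q0; rewrite subr_ge0. Qed.

Section Family.
Variables (I : finType).
Implicit Types (J : {set I}) (A : I -> {set E * C}).

Definition hits J A W := [exists i in J, A i \subset W].

Definition fail_prob q J A : R :=
  \sum_c prod_law (color_law q) c * (~~ hits J A (graph c))%:R.

Lemma hits_sub J A W W' : W \subset W' -> hits J A W -> hits J A W'.
Proof.
move=> sW /exists_inP[i iJ sA]; apply/exists_inP; exists i => //.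
exact: subset_trans sA sW.
Qed.

Section Hybrid.
Variables (J : {set I}) (A : I -> {set E * C}) (q1 q2 : R).
Hypothesis A_fun : forall i, i \in J -> {in A i &, injective fst}.
Hypotheses (q1_ge0 : 0 <= q1) (q2_ge0 : 0 <= q2).
Hypothesis q12_le1 : (q1 + q2) * #|C|%:R <= 1.

(** Each coordinate carries three independent values, of rates [q1 + q2], [q1] and [q2], so that all
    hybrids live on one probability space. *)
Let O3 : finType := (option C * (option C * option C))%type.

Let v (y : O3) : R :=
  color_law (q1 + q2) y.1 * (color_law q1 y.2.1 * color_law q2 y.2.2).

Let q1_le1 : q1 * #|C|%:R <= 1.
Proof. by apply: le_trans q12_le1; rewrite ler_wpM2r ?ler0n // lerDl. Qed.

Let q2_le1 : q2 * #|C|%:R <= 1.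
Proof. by apply: le_trans q12_le1; rewrite ler_wpM2r ?ler0n // lerDr. Qed.

Let v_ge0 y : 0 <= v y.
Proof. by rewrite /v !mulr_ge0 ?color_law_ge0 ?addr_ge0. Qed.

Let sum_v1 (f : option C -> R) :
  \sum_y v y * f y.1 = \sum_o color_law (q1 + q2) o * f o.
Proof.
transitivity (\sum_y (color_law (q1 + q2) y.1 * f y.1) *
   (color_law q1 y.2.1 * color_law q2 y.2.2)).
  by apply: eq_bigr => y _; rewrite /v; ring.
rewrite (sum_pair_mul (fun o => color_law (q1 + q2) o * f o)
  (fun y => color_law q1 y.1 * color_law q2 y.2)).
by rewrite (sum_pair_mul (color_law q1) (color_law q2)) !sum_color_law !mulr1.
Qed.

Let sum_v2 (f : option C -> R) :
  \sum_y v y * f y.2.1 = \sum_o color_law q1 o * f o.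
Proof.
transitivity (\sum_(y : O3) color_law (q1 + q2) y.1 *
   ((color_law q1 y.2.1 * f y.2.1) * color_law q2 y.2.2)).
  by apply: eq_bigr => y _; rewrite /v; ring.
rewrite (sum_pair_mul (color_law (q1 + q2))
  (fun y => (color_law q1 y.1 * f y.1) * color_law q2 y.2)).
rewrite (sum_pair_mul (fun o => color_law q1 o * f o) (color_law q2)).
by rewrite !sum_color_law mulr1 mul1r.
Qed.

Let sum_v3 (f : option C -> R) :
  \sum_y v y * f y.2.2 = \sum_o color_law q2 o * f o.
Proof.
transitivity (\sum_(y : O3) color_law (q1 + q2) y.1 *
   (color_law q1 y.2.1 * (color_law q2 y.2.2 * f y.2.2))).
  by apply: eq_bigr => y _; rewrite /v; ring.
rewrite (sum_pair_mul (color_law (q1 + q2))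
  (fun y => color_law q1 y.1 * (color_law q2 y.2 * f y.2))).
rewrite (sum_pair_mul (color_law q1) (fun o => color_law q2 o * f o)).
by rewrite !sum_color_law !mul1r.
Qed.

Let sum_v : \sum_y v y = 1.
Proof.
rewrite -[RHS](sum_color_law (q1 + q2)).
transitivity (\sum_y v y * 1); first by apply: eq_bigr => y _; rewrite mulr1.
by rewrite (sum_v1 (fun _ => 1)); apply: eq_bigr => y _; rewrite mulr1.
Qed.

(* On the coordinates in [B] the two independent layers are replaced by a
   single one; [B] grows one coordinate at a time. *)
Let hybrid (B : {set E}) (z : {ffun E -> O3}) : {set E * C} :=
  [set x | if x.1 \in B then (z x.1).1 == Some x.2
           else ((z x.1).2.1 == Some x.2) || ((z x.1).2.2 == Some x.2)].

Let fails W : R := (~~ hits J A W)%:R.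

(** Condition on all coordinates but [e]. If a color at [e] is needed and [g] colors would do, a
    single layer succeeds with probability [(q1 + q2) * g], while two layers succeed with at most
    [q1 * g + q2 * g] by the union bound. *)
Let hybrid_step (B : {set E}) e : e \notin B ->
  \sum_z prod_law v z * fails (hybrid (e |: B) z) <=
  \sum_z prod_law v z * fails (hybrid B z).
Proof.
move=> eB; rewrite (sum_prod_law_resample _ e) //.
rewrite [leRHS](sum_prod_law_resample _ e) //.
apply: ler_sum => z _; apply: ler_wpM2l; first exact: prod_law_ge0.
pose W0 := [set x in hybrid B z | x.1 != e].
pose ext o := W0 :|: [set x | (x.1 == e) && (o == Some x.2)].
have W1E y : hybrid (e |: B) (update z e y) = ext y.1.
  apply/setP => x; rewrite !inE ffunE; case: (eqVneq x.1 e) => [->|_] /=.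
    by rewrite andbF.
  by rewrite andbT orbF.
have W2E y : hybrid B (update z e y) = ext y.2.1 :|: ext y.2.2.
  apply/setP => x; rewrite !inE ffunE; case: (eqVneq x.1 e) => [->|_] /=.
    by rewrite (negbTE eB) !andbF.
  by rewrite andbT !orbF orbb.
have ext0 o : W0 \subset ext o by rewrite subsetUl.
have extN : ext None = W0.
  by apply/setP => x; rewrite !inE andbF orbF.
pose b o := hits J A (ext o).
(* A member uses at most one color at [e], so one of the two layers alone provides it. *)
have b12 y : hits J A (hybrid B (update z e y)) -> b y.2.1 || b y.2.2.
  rewrite W2E => /exists_inP[i iJ sA].
  have [/existsP[x /andP[xA /eqP xe]]|none] :=
      boolP [exists x, (x \in A i) && (x.1 == e)].
    have xW := subsetP sA x xA.
    suff H o : x \in ext o -> b o.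
      by move: xW; rewrite inE => /orP[/H ->|/H ->]; rewrite ?orbT.
    move=> xo; apply/exists_inP; exists i => //; apply/subsetP => u uA.
    have [ue|ue] := eqVneq u.1 e.
      by rewrite (A_fun iJ uA xA) // ue xe.
    move: (subsetP sA u uA); rewrite /ext !inE (negbTE ue) /= !orbF.
    by move=> /orP[]/andP[-> _].
  apply/orP; left; apply/exists_inP; exists i => //.
  apply/subsetP => u uA; have ue : u.1 != e.
    by move: none; rewrite negb_exists => /forallP/(_ u); rewrite uA.
  move: (subsetP sA u uA); rewrite /ext !inE (negbTE ue) /= !orbF.
  by move=> /orP[]/andP[-> _].
(* If a member is already hit without [e], the left side vanishes. *)
have [b0|nb0] := boolP (b None).
  rewrite big1 => [|y _].
    by apply: sumr_ge0 => y _; rewrite mulr_ge0 // ler0n.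
  rewrite W1E /fails (hits_sub (ext0 y.1)) ?mulr0 //.
  by move: b0; rewrite /b extN.
have -> : \sum_y v y * fails (hybrid (e |: B) (update z e y)) =
   1 - \sum_y v y * (b y.1)%:R.
  rewrite -[X in X - _]sum_v -sumrB; apply: eq_bigr => y _.
  by rewrite W1E /fails /b; case: hits; rewrite /= ?mulr0 ?mulr1 ?subrr ?subr0.
have : 1 - \sum_y v y * (b y.2.1)%:R - \sum_y v y * (b y.2.2)%:R <=
    \sum_y v y * fails (hybrid B (update z e y)).
  rewrite -[X in X - _ - _]sum_v -!sumrB; apply: ler_sum => y _.
  rewrite -{1}[v y]mulr1 -!mulrBr ler_wpM2l // /fails.
  move: (b12 y); case: hits => /=.
    by move=> /(_ isT); case: (b _); case: (b _) => //= _; lra.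
  by move=> _; case: (b _); case: (b _) => /=; lra.
apply: le_trans.
rewrite (sum_v1 (fun o => (b o)%:R)) (sum_v2 (fun o => (b o)%:R)).
rewrite (sum_v3 (fun o => (b o)%:R)) !sum_color_law_fun //.
by rewrite mulrDl opprD addrA.
Qed.

(* McDiarmid's comparison: as each [A i] meets a coordinate at most once, the
   union bound for two independent layers is exact for disjoint colors. *)
Lemma fail_prob_add :
  fail_prob (q1 + q2) J A <=
  \sum_c1 prod_law (color_law q1) c1 * \sum_c2 prod_law (color_law q2) c2 *
     (~~ hits J A (graph c1 :|: graph c2))%:R.
Proof.
have step B : \sum_z prod_law v z * fails (hybrid B z) <=
    \sum_z prod_law v z * fails (hybrid set0 z).
  elim: {B}#|B| {-2}B (erefl #|B|) => [|m IH] B.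
    by move/eqP; rewrite cards_eq0 => /eqP ->.
  move=> Bm; have [e eB] : exists e, e \in B by apply/card_gt0P; rewrite Bm.
  have eB' : e \notin B :\ e by rewrite !inE eqxx.
  rewrite -(setD1K eB); apply: le_trans (hybrid_step eB') _.
  by apply: IH; move: Bm; rewrite (cardsD1 e) eB => -[].
(* The full hybrid reads only the merged layer and the empty one only the two separate layers; the
   other components integrate to one. *)
apply: le_trans (le_trans _ (step setT)) _.
  rewrite le_eqVlt; apply/orP; left; apply/eqP.
  have /= H := sum_prod_law_pair (E := E) (color_law (q1 + q2))
    (fun y : option C * option C => color_law q1 y.1 * color_law q2 y.2)
    (fun c _ => (~~ hits J A (graph c))%:R).
  transitivity (\sum_z prod_law v z *
     (~~ hits J A (graph [ffun e => (z e).1]))%:R); last first.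
    apply: eq_bigr => z _; congr (_ * (~~ hits _ _ _)%:R).
    by apply/setP => x; rewrite !inE ffunE.
  rewrite [RHS]H; apply: eq_bigr => c _; congr (_ * _).
  rewrite -mulr_suml sum_prod_law ?mul1r //.
  by rewrite (sum_pair_mul (color_law q1) (color_law q2)) !sum_color_law mulr1.
rewrite le_eqVlt; apply/orP; left; apply/eqP.
have /= H := sum_prod_law_pair (E := E) (color_law (q1 + q2))
    (fun y : option C * option C => color_law q1 y.1 * color_law q2 y.2)
    (fun _ d => (~~ hits J A (graph [ffun e => (d e).1] :|:
                             graph [ffun e => (d e).2]))%:R).
transitivity (\sum_z prod_law v z *
     (~~ hits J A (graph [ffun e => ([ffun e => (z e).2] e).1] :|:
                   graph [ffun e => ([ffun e => (z e).2] e).2]))%:R).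
  apply: eq_bigr => z _; congr (_ * (~~ hits _ _ _)%:R).
  by apply/setP => x; rewrite !inE !ffunE.
rewrite H -mulr_suml sum_prod_law ?sum_color_law // mul1r.
exact: (sum_prod_law_pair (color_law q1) (color_law q2)
  (fun c1 c2 => (~~ hits J A (graph c1 :|: graph c2))%:R)).
Qed.

End Hybrid.
End Family.
End ColorModel.

(** * The spread lemma *)

Section Fragments.
Variables (R : realFieldType) (E C : finType).
Implicit Types (c z : {ffun E -> option C}) (S : {set E * C}).

(** A substitute for the union of [graph c] and [S] that keeps one color per coordinate: [S]
    prevails. *)
Definition override c S : {ffun E -> option C} :=
  [ffun e => if [pick y | (e, y) \in S] is Some y then Some y else c e].

Lemma override_in c S x : {in S &, injective fst} -> x \in S ->
  override c S x.1 = Some x.2.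
Proof.
move=> S_fun xS; rewrite ffunE; case: pickP => [y yS|/(_ x.2)].
  by rewrite (congr1 snd (S_fun _ _ xS yS erefl)).
by rewrite -surjective_pairing xS.
Qed.

Lemma override_out c S e : (forall y, (e, y) \notin S) -> override c S e = c e.
Proof. by move=> eS; rewrite ffunE; case: pickP => // y; rewrite (negbTE (eS y)). Qed.

(** The colorings [c] summed over agree with [z] off the coordinates of [S] and are arbitrary on
    them. Summing out the free coordinates leaves the law of [z] without one factor [q] per element
    of [S]. *)
Lemma sum_override (q : R) z S :
  {in S &, injective fst} -> S \subset graph z ->
  (\sum_(c | override c S == z) prod_law (color_law q) c) * q ^+ #|S| =
  prod_law (color_law q) z.
Proof.
move=> S_fun Sz; pose D := [set x.1 | x in S].
pose Q e := [pred o | (e \in D) || (o == z e)].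
have zS x : x \in S -> z x.1 = Some x.2.
  by move=> /(subsetP Sz); rewrite inE => /eqP.
have notD e y : e \notin D -> (e, y) \notin S.
  by apply: contra => eyS; apply/imsetP; exists (e, y).
rewrite (eq_bigl (fun c => c \in family Q)); last first.
  move=> c; apply/eqP/familyP => [ov e|cQ].
    rewrite inE /=; have [//|eD] := boolP (e \in D).
    by rewrite -ov override_out //= => y; apply: notD.
  apply/ffunP => e; have [/imsetP[x xS ->]|eD] := boolP (e \in D).
    by rewrite override_in // zS.
  rewrite override_out => [|y]; last exact: notD.
  by have := cQ e; rewrite inE /= (negbTE eD) => /eqP.
rewrite -(bigA_distr_big_dep Q (fun _ => color_law q)).
rewrite (bigID (mem D)) [in RHS]/prod_law [in RHS](bigID (mem D)) /=.
rewrite mulrAC; congr (_ * _); last first.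
  by apply: eq_bigr => e eD; rewrite (negbTE eD) /= big_pred1_eq.
rewrite big1 ?mul1r => [|e eD]; last first.
  by rewrite (eq_bigl xpredT) => [|o]; rewrite ?eD ?sum_color_law.
rewrite -(card_in_imset S_fun) -prodr_const; apply: eq_bigr => e /imsetP[x xS ->].
by rewrite zS.
Qed.

Section Family.
Variables (I : finType) (J : {set I}) (A : I -> {set E * C}).
Hypothesis A_fun : forall i, i \in J -> {in A i &, injective fst}.

Definition fragment_source c i : I :=
  [arg min_(i' < i | (i' \in J) && (A i' :\: graph c \subset A i))
     #|A i' :\: graph c|].

Definition fragment c i : {set E * C} := A (fragment_source c i) :\: graph c.

Lemma fragment_sourceP c i : i \in J ->
  [/\ fragment_source c i \in J, fragment c i \subset A i &
      forall i', i' \in J -> A i' :\: graph c \subset A i ->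
        #|fragment c i| <= #|A i' :\: graph c| ]%N.
Proof.
move=> iJ; rewrite /fragment /fragment_source; case: arg_minnP.
  by rewrite iJ subsetDl.
move=> i0 /andP[-> ->] min_i0; split=> // i' i'J sA.
by apply: min_i0; rewrite i'J.
Qed.

Lemma fragment_fun c i : i \in J -> {in fragment c i &, injective fst}.
Proof.
move=> iJ; have [sJ _ _] := fragment_sourceP c iJ.
move=> x y; rewrite !inE => /andP[_ xA] /andP[_ yA].
exact: (A_fun sJ).
Qed.

(** The fragment restores what [c] misses, and it overwrites nothing else of the source, which has
    at most one color per coordinate. *)
Lemma source_sub_override c i : i \in J ->
  A (fragment_source c i) \subset graph (override c (fragment c i)).
Proof.
move=> iJ; have [sJ _ _] := fragment_sourceP c iJ.
apply/subsetP => x xA; rewrite inE.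
have [xc|xc] := boolP (x \in graph c); last first.
  by rewrite override_in ?eqxx //; [exact: fragment_fun|rewrite inE xc].
rewrite override_out; first by rewrite inE in xc.
move=> y; apply/negP; rewrite inE => /andP[yc yA].
by move: xc; rewrite (A_fun sJ xA yA) // (negbTE yc).
Qed.

(* The member of the family inside [graph (override c T)] is chosen from that
   graph alone, and still contains the fragment [T]: given the graph, there are
   few candidates for [T]. *)
Lemma fragment_sub_member c i i' : i \in J -> i' \in J ->
  A i' \subset graph (override c (fragment c i)) -> fragment c i \subset A i'.
Proof.
move=> iJ i'J sA; have [sJ sf min_f] := fragment_sourceP c iJ.
have sub : A i' :\: graph c \subset fragment c i.
  apply/subsetP => x; rewrite in_setD => /andP[xc xA].
  have := subsetP sA x xA; rewrite inE ffunE; case: pickP => [y yS /eqP[yx]|_].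
    by rewrite (surjective_pairing x) -yx.
  by move: xc; rewrite inE => /negbTE ->.
have := min_f i' i'J (subset_trans sub sf) => le_card.
have /eqP <- : A i' :\: graph c == fragment c i by rewrite eqEcard sub.
exact: subsetDl.
Qed.

Variables (q kappa N : R) (l : nat).
Hypotheses (q_ge0 : 0 <= q) (q_le1 : q * #|C|%:R <= 1).
Hypotheses (kappa_ge0 : 0 <= kappa) (N_ge0 : 0 <= N).
Hypothesis A_card : forall i, i \in J -> (#|A i| <= l)%N.
Hypothesis A_spread : forall S : {set E * C},
  #|[set i in J | S \subset A i]|%:R * kappa ^+ #|S| <= N.

Let law := @prod_law R E _ (@color_law R C q).

Let law_ge0 c : 0 <= law c.
Proof. by apply: prod_law_ge0 => o; apply: color_law_ge0. Qed.

(** Sum over pairs of a coloring [z = override c S] and a fragment [S] of size [t]. Each [z] allows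
    at most ['C(l, t)] sets [S]; the law of the possible [c] sums to the law of [z] over [q ^+ t];
    and spreadness bounds the members containing [S] by [N / kappa ^+ t]. *)
Lemma fragment_card_eq t :
  (\sum_c law c * #|[set i in J | #|fragment c i| == t]|%:R) *
    (q * kappa) ^+ t <= N * 'C(l, t)%:R.
Proof.
(* The default [set0] only keeps the size and injectivity bounds valid for all [z]; an override by a
   fragment always contains a member. *)
pose member z := if [pick i | (i \in J) && (A i \subset graph z)] is Some i
  then A i else set0.
have member_sub z : member z \subset graph z.
  by rewrite /member; case: pickP => [i /andP[]|] //; rewrite sub0set.
have member_fun z : {in member z &, injective fst}.
  rewrite /member; case: pickP => [i /andP[iJ _]|_]; first exact: A_fun.
  by move=> x; rewrite inE.
have member_card z : (#|member z| <= l)%N.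
  rewrite /member; case: pickP => [i /andP[iJ _]|_]; first exact: A_card.
  by rewrite cards0.
pose Q z S := (S \subset member z) && (#|S| == t).
pose num S := #|[set i in J | S \subset A i]|.
have count c : (#|[set i in J | #|fragment c i| == t]| <=
    \sum_(S | Q (override c S) S) num S)%N.
  apply: (@leq_trans #|\bigcup_(S | Q (override c S) S)
      [set i in J | S \subset A i]|).
    apply: subset_leq_card; apply/subsetP => i; rewrite inE => /andP[iJ ti].
    have [sJ sf _] := fragment_sourceP c iJ.
    apply/bigcupP; exists (fragment c i); last by rewrite inE iJ.
    rewrite /Q ti andbT /member; case: pickP => [i' /andP[i'J sA]|].
      exact: fragment_sub_member.
    by move/(_ (fragment_source c i)); rewrite sJ source_sub_override.
  exact: leq_card_bigcup.
apply: le_trans (_ : (\sum_c \sum_(S | Q (override c S) S)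
    law c * (num S)%:R) * (q * kappa) ^+ t <= _).
  apply: ler_wpM2r; first by rewrite exprn_ge0 // mulr_ge0.
  apply: ler_sum => c _; rewrite -mulr_sumr ler_wpM2l //.
  by rewrite -natr_sum ler_nat.
rewrite (exchange_big_dep xpredT) //= mulr_suml.
apply: le_trans (_ : \sum_S \sum_(z | Q z S) N * law z <= _).
  apply: ler_sum => S _.
  rewrite (partition_big (fun c => override c S) (fun z => Q z S)) //=.
  rewrite mulr_suml; apply: ler_sum => z /andP[Sz /eqP St].
  rewrite (eq_bigl (fun c => override c S == z)); last first.
    move=> c; apply: andb_idl => /eqP ->.
    by rewrite /Q Sz St eqxx.
  have S_fun : {in S &, injective fst}.
    by apply: sub_in2 (member_fun z); apply/subsetP.
  rewrite -[law z](sum_override q S_fun (subset_trans Sz (member_sub z))) -St.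
  rewrite -mulr_suml exprMn.
  rewrite [leLHS](_ : _ = (num S)%:R * kappa ^+ #|S| *
    ((\sum_(c | override c S == z) law c) * q ^+ #|S|)); last by ring.
  apply: ler_wpM2r; last exact: A_spread.
  by rewrite mulr_ge0 ?exprn_ge0 ?sumr_ge0.
rewrite (exchange_big_dep xpredT) //=.
apply: le_trans (_ : \sum_z N * 'C(l, t)%:R * law z <= _); last first.
  by rewrite -mulr_sumr sum_prod_law ?sum_color_law ?mulr1.
apply: ler_sum => z _; rewrite sumr_const -[leLHS]mulr_natr mulrAC.
apply: ler_wpM2r => //; apply: ler_wpM2l => //; rewrite ler_nat.
apply: leq_trans (leq_bin2l t (member_card z)).
by rewrite -cards_draws cardsE.
Qed.

(** Since [q * kappa] is at least one, exponents [t >= a] may be lowered to [a]. The binomials sum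
    to [2 ^ l], at most [4 ^ a]. *)
Lemma fragment_card_ge a : (l <= a.*2)%N -> 4%:R <= q * kappa ->
  \sum_c law c * #|[set i in J | (a <= #|fragment c i|)%N]|%:R <=
  N * (4%:R / (q * kappa)) ^+ a.
Proof.
move=> la L4; have L0 : 0 < q * kappa by lra.
rewrite expr_div_n mulrA ler_pdivlMr ?exprn_gt0 //.
have count c : (#|[set i in J | a <= #|fragment c i|]| <=
    \sum_(t < l.+1 | a <= t) #|[set i in J | #|fragment c i| == t]|)%N.
  apply: (@leq_trans #|\bigcup_(t < l.+1 | (a <= t)%N)
      [set i in J | #|fragment c i| == t]|).
    apply: subset_leq_card; apply/subsetP => i; rewrite inE => /andP[iJ ti].
    have [_ sf _] := fragment_sourceP c iJ.
    have tl : (#|fragment c i| < l.+1)%N.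
      by rewrite ltnS (leq_trans (subset_leq_card sf)) // A_card.
    by apply/bigcupP; exists (Ordinal tl); rewrite // inE iJ /=.
  exact: leq_card_bigcup.
apply: le_trans (_ : \sum_(t < l.+1) N * 'C(l, t)%:R <= _); last first.
  rewrite -mulr_sumr -natr_sum; apply: ler_wpM2l => //.
  rewrite -natrX ler_nat.
  have -> : (\sum_(t < l.+1) 'C(l, t) = 2 ^ l)%N.
    rewrite -[2%N]/(1 + 1)%N expnDn; apply: eq_bigr => t _.
    by rewrite !exp1n !muln1.
  by rewrite -[4%N]/(2 ^ 2)%N -expnM leq_exp2l // mul2n.
apply: le_trans (_ : \sum_(t < l.+1 | (a <= t)%N) (\sum_c law c *
    #|[set i in J | #|fragment c i| == t]|%:R) * (q * kappa) ^+ t <= _).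
  rewrite mulr_suml.
  apply: le_trans (_ : \sum_c \sum_(t < l.+1 | (a <= t)%N) law c *
    #|[set i in J | #|fragment c i| == t]|%:R * (q * kappa) ^+ t <= _).
    apply: ler_sum => c _.
    apply: le_trans (_ : \sum_(t < l.+1 | (a <= t)%N) law c *
      #|[set i in J | #|fragment c i| == t]|%:R * (q * kappa) ^+ a <= _).
      rewrite -mulr_suml -mulr_sumr -natr_sum; apply: ler_wpM2r.
        by rewrite exprn_ge0 // ltW.
      by apply: ler_wpM2l => //; rewrite ler_nat.
    apply: ler_sum => t at_; apply: ler_wpM2l; first by rewrite mulr_ge0.
    by rewrite ler_weXn2l //; lra.
  by rewrite exchange_big /=; apply: ler_sum => t _; rewrite mulr_suml.
apply: le_trans (_ : \sum_(t < l.+1 | (a <= t)%N) N * 'C(l, t)%:R <= _).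
  by apply: ler_sum => t _; apply: fragment_card_eq.
rewrite [leRHS](bigID (fun t : 'I_l.+1 => (a <= t)%N)) /= lerDl sumr_ge0 // => t _.
by rewrite mulr_ge0.
Qed.

End Family.

(** Induction on the number [m] of rounds. One round is exposed; members whose fragments keep
    [2 ^ m] elements or more count as failures, and the other fragments form a family with the same
    [N], being subsets of the members. Multiplying by the size of [J] avoids renormalization. *)
Lemma spread_fail_prob (q kappa N : R) :
  0 <= q -> 8%:R <= q * kappa -> 0 <= kappa -> 0 <= N ->
  forall (m : nat) (I : finType) (J : {set I}) (A : I -> {set E * C}),
  q * m%:R * #|C|%:R <= 1 ->
  (forall i, i \in J -> {in A i &, injective fst}) ->
  (forall i, i \in J -> (#|A i| < 2 ^ m)%N) ->
  (forall S, #|[set i in J | S \subset A i]|%:R * kappa ^+ #|S| <= N) ->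
  #|J|%:R * fail_prob (q * m%:R) J A <=
    N * (4%:R / (q * kappa)) * (2%:R - 2%:R / 2%:R ^+ m).
Proof.
move=> q0 L8 k0 N0; set x := 4%:R / (q * kappa).
have L0 : 0 < q * kappa by lra.
have x0 : 0 <= x by rewrite divr_ge0 // ltW.
have x12 : x <= 2%:R^-1 by rewrite /x ler_pdivrMr //; lra.
elim=> [|m IH] I J A qm1 A_fun A_card A_spread.
  rewrite mulr0 expr0 divr1 subrr mulr0.
  have [->|[i iJ]] := set_0Vmem J; first by rewrite cards0 mul0r.
  rewrite /fail_prob big1 ?mulr0 // => c _.
  have -> : hits J A (graph c).
    apply/exists_inP; exists i => //; have := A_card i iJ.
    by rewrite expn0 ltnS leqn0 cards_eq0 => /eqP ->; rewrite sub0set.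
  by rewrite mulr0.
have qmE : q * m.+1%:R = q + q * m%:R by rewrite -natr1; ring.
have C0 : 0 <= #|C|%:R :> R by [].
have qm0 : 0 <= q * m%:R by rewrite mulr_ge0.
have q1 : q * #|C|%:R <= 1.
  by apply: le_trans qm1; rewrite qmE ler_wpM2r // lerDl.
have qm1' : q * m%:R * #|C|%:R <= 1.
  by apply: le_trans qm1; rewrite qmE ler_wpM2r // lerDr.
pose law := @prod_law R E _ (@color_law R C q).
have law0 c : 0 <= law c by apply: prod_law_ge0 => o; apply: color_law_ge0.
pose law' := @prod_law R E _ (@color_law R C (q * m%:R)).
have law'0 c : 0 <= law' c by apply: prod_law_ge0 => o; apply: color_law_ge0.
pose J1 c := [set i in J | #|fragment J A c i| < 2 ^ m]%N.
pose J2 c := [set i in J | 2 ^ m <= #|fragment J A c i|]%N.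
have cardJ c : #|J|%:R = #|J2 c|%:R + #|J1 c|%:R :> R.
  rewrite -natrD; congr _%:R; rewrite -(cardsID [set i | 2 ^ m <= #|fragment J A c i|]%N J).
  congr addn; apply: eq_card => i; rewrite !inE //=.
  by rewrite -ltnNge andbC.
have fail1 c : fail_prob (q * m%:R) (J1 c) (fragment J A c) <= 1.
  rewrite -[leRHS](sum_prod_law E (sum_color_law C (q * m%:R))).
  apply: ler_sum => d _; rewrite -[leRHS]mulr1.
  by apply: ler_wpM2l; [exact: law'0|case: hits].
apply: le_trans (_ : \sum_c law c * (#|J2 c|%:R + #|J1 c|%:R *
    fail_prob (q * m%:R) (J1 c) (fragment J A c)) <= _).
  apply: le_trans (_ : \sum_c law c * (#|J|%:R *
    fail_prob (q * m%:R) (J1 c) (fragment J A c)) <= _); last first.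
    apply: ler_sum => c _; apply: ler_wpM2l => //; rewrite (cardJ c) mulrDl lerD2r.
    by rewrite -[leRHS]mulr1 ler_wpM2l.
  rewrite (eq_bigr (fun c => #|J|%:R *
      (law c * fail_prob (q * m%:R) (J1 c) (fragment J A c)))); last first.
    by move=> c _; rewrite mulrCA.
  rewrite -mulr_sumr; apply: ler_wpM2l => //; rewrite qmE.
  apply: le_trans (fail_prob_add A_fun q0 qm0 _) _; first by rewrite -qmE.
  apply: ler_sum => c _; apply: ler_wpM2l; first exact: law0.
  apply: ler_sum => d _; apply: ler_wpM2l; first exact: law'0.
  have sub : hits (J1 c) (fragment J A c) (graph d) ->
      hits J A (graph c :|: graph d).
    move=> /exists_inP[i]; rewrite inE => /andP[iJ _] sA.
    have [sJ _ _] := fragment_sourceP A c iJ.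
    by apply/exists_inP; exists (fragment_source J A c i); rewrite // -subDset.
  by rewrite ler_nat; case h: (hits J A _) => //; rewrite (contraFF sub h).
apply: le_trans (_ : N * x ^+ (2 ^ m) + N * x * (2%:R - 2%:R / 2%:R ^+ m) <= _).
  rewrite (eq_bigr (fun c => law c * #|J2 c|%:R + law c * (#|J1 c|%:R *
      fail_prob (q * m%:R) (J1 c) (fragment J A c)))); last first.
    by move=> c _; rewrite mulrDr.
  rewrite big_split /=; apply: lerD.
    apply: (@fragment_card_ge I J A A_fun q kappa N (2 ^ m.+1).-1) => //.
    - by move=> i iJ; rewrite -ltnS prednK ?expn_gt0 // A_card.
    - by rewrite -mul2n -expnS leq_pred.
    - lra.
  apply: le_trans (_ : \sum_c law c * (N * x * (2%:R - 2%:R / 2%:R ^+ m)) <= _).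
    apply: ler_sum => c _; apply: ler_wpM2l; first exact: law0.
    apply: IH => // [i|i|S].
    - by rewrite inE => /andP[iJ _]; apply: fragment_fun.
    - by rewrite inE => /andP[].
    apply: le_trans (A_spread S); rewrite ler_wpM2r ?exprn_ge0 // ler_nat.
    apply: subset_leq_card; apply/subsetP => i; rewrite !inE => /andP[/andP[iJ _] sS].
    by rewrite iJ; have [_ sf _] := fragment_sourceP A c iJ; exact: subset_trans sS sf.
  by rewrite -mulr_suml sum_prod_law ?sum_color_law // mul1r.
(* As [x] is at most one half, the losses of the rounds are dominated by a geometric series. *)
have xm : x ^+ (2 ^ m) <= x / 2%:R ^+ m.
  have m2 : (m.+1 <= 2 ^ m)%N by rewrite ltn_expl.
  apply: le_trans (_ : x ^+ m.+1 <= _).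
    by rewrite ler_wiXn2l //; lra.
  by rewrite exprS ler_wpM2l // -exprVn lerXn2r ?nnegrE ?invr_ge0 //.
apply: le_trans (_ : N * (x / 2%:R ^+ m) + N * x * (2%:R - 2%:R / 2%:R ^+ m) <= _).
  by rewrite lerD2r ler_wpM2l.
have -> : 2%:R / 2%:R ^+ m.+1 = (2%:R ^+ m)^-1 :> R.
  by rewrite exprS invfM mulrA divff ?mul1r ?pnatr_eq0.
by rewrite le_eqVlt; apply/orP; left; apply/eqP; ring.
Qed.

End Fragments.

(** * From the family to Hamilton cycles *)

Section HamiltonCycle.
Local Open Scope nat_scope.
Variables (d r : nat).
Hypotheses (d_gt1 : 1 < d) (r_gt1 : 1 < r).

Let d_gt0 : 0 < d := ltnW d_gt1.
Let j0 : 'I_d := Ordinal d_gt0.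
Let i0 : 'I_r := Ordinal (ltnW r_gt1).

Variable w : cycle_index d r.
Hypothesis wJ : w \in cycle_indices d r.

(** The colors in the order in which the cycle traverses its edges. *)
Let u m := iter m w.1 i0.

Let porbit_full : #|porbit w.1 i0| = r.
Proof.
move: wJ; rewrite !inE => /andP[_]; rewrite cardsT !card_ord -add1n eqn_add2r.
move=> /cards1P[B BE].
have orbitE i : porbit w.1 i = B.
  by apply/set1P; rewrite -BE; apply: imset_f.
rewrite -[RHS]card_ord -cardsT; apply: eq_card => i.
by rewrite orbitE -(orbitE i) porbit_id inE.
Qed.

Let u_period m : u (m %% r) = u m.
Proof.
have fix_r : iter r w.1 i0 = i0 by rewrite -[RHS](iter_porbit w.1) porbit_full.
have fix_mul q : iter (q * r) w.1 i0 = i0.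
  by elim: q => //= q IH; rewrite mulSn iterD IH.
by rewrite [in RHS](divn_eq m r) /u addnC iterD fix_mul.
Qed.

Let u_inj : {in gtn r &, injective u}.
Proof.
move=> m m' mr m'r um; have := uniq_traject_porbit w.1 i0; rewrite porbit_full.
move=> /(nth_uniq i0); rewrite size_traject => /(_ m m' mr m'r).
by rewrite !nth_traject // -!/(u _) um eqxx => /esym/eqP.
Qed.

Let u_surj i : exists2 m, m < r & i = u m.
Proof.
have : i \in porbit w.1 i0.
  have /eqP -> : porbit w.1 i0 == [set: 'I_r]; last by rewrite inE.
  by rewrite eqEcard subsetT cardsT card_ord porbit_full /=.
by rewrite porbit_traject porbit_full => /trajectP[m mr ->]; exists m.
Qed.

(** Position [m] belongs to edge [m %/ d] of the traversal and holds its vertex of class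
    [m %% d]. *)
Let place m : 'I_(r * d) :=
  let j := Ordinal (ltn_pmod m d_gt0) in vertex j (w.2 j (u (m %/ d))).

Let placeE m (j : 'I_d) : place (m * d + j) = vertex j (w.2 j (u m)).
Proof.
rewrite /place /=; have -> : Ordinal (ltn_pmod (m * d + j) d_gt0) = j.
  by apply: val_inj; rewrite /= modnMDl modn_small.
by rewrite divnMDl // divn_small // addn0.
Qed.

Let place_period m : place (m %% (r * d)) = place m.
Proof.
rewrite /place -modn_divl u_period.
have -> // : Ordinal (ltn_pmod (m %% (r * d)) d_gt0) = Ordinal (ltn_pmod m d_gt0).
by apply: val_inj; rewrite /= modn_dvdm // dvdn_mull.
Qed.

Let place_inj : injective (fun x : 'I_(r * d) => place x).
Proof.
move=> x y /vertex_inj[/(congr1 val) /= jE].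
have -> : Ordinal (ltn_pmod x d_gt0) = Ordinal (ltn_pmod y d_gt0) by apply: val_inj.
move=> /perm_inj /u_inj; rewrite !inE !ltn_divLR // => /(_ (ltn_ord x) (ltn_ord y)) qE.
by apply: val_inj; rewrite /= (divn_eq x d) (divn_eq y d) qE jE.
Qed.

Lemma loose_edgeE m : loose_edge d.+1 (perm place_inj) m = cycle_edge d_gt1 w (u m).
Proof.
have jE (j : 'I_d.+1) : place (m * d + j) \in cycle_edge d_gt1 w (u m).
  have := ltn_ord j; rewrite ltnS leq_eqVlt => /orP[/eqP ->|jd].
    (* The last position of an edge is the first of the next one, whose vertex in class [j0] is
       shared. *)
    rewrite (_ : (m * d + d) = m.+1 * d + j0)%N; last by rewrite addn0 mulSn addnC.
    by rewrite placeE vertex_in_cycle_edge eqxx /= eqxx orbT.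
  by rewrite (placeE m (Ordinal jd)) vertex_in_cycle_edge eqxx.
have rd_gt0 : 0 < r * d by rewrite muln_gt0 d_gt0 ltnW.
have inE_loose (j : 'I_d.+1) : place (m * d + j) \in loose_edge d.+1 (perm place_inj) m.
  apply/imsetP; exists (Ordinal (ltn_pmod (m * d + j) rd_gt0)).
    by rewrite inE; apply/existsP; exists j.
  by rewrite permE /= place_period.
apply/setP => y; apply/idP/idP.
  move=> /imsetP[x]; rewrite inE => /existsP[j /eqP xj] ->.
  by rewrite permE xj place_period jE.
rewrite !inE => /orP[/eqP ->|/imsetP[j _ ->]]; last first.
  by rewrite -placeE (inE_loose (widen_ord (leqnSn d) j)).
have := inE_loose ord_max; rewrite /=.
rewrite (_ : (m * d + d) = m.+1 * d + j0)%N; last by rewrite addn0 mulSn addnC.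
by rewrite placeE.
Qed.

Lemma cycle_member_rainbow (H : colored_hypergraph d.+1 (r * d) r) :
  cycle_member d_gt1 w \subset graph H -> has_rainbow_loose_Hamilton_cycle H.
Proof.
move=> wH; pose C := [set cycle_edge d_gt1 w i | i : 'I_r].
(* The color found on an edge is its own index, hence the cycle is rainbow. *)
have color i : edge_color H (cycle_edge d_gt1 w i) = Some i.
  have card_e : #|cycle_edge d_gt1 w i| == d.+1.
    by rewrite (card_cycle_edge d_gt1 r_gt1).
  rewrite /edge_color insubT /=.
  have := subsetP wH (Sub (cycle_edge d_gt1 w i) card_e, i).
  by rewrite !inE /= eqxx => /(_ isT)/eqP <-.
apply/existsP; exists C; apply/and3P; split.
- apply/existsP; exists (perm place_inj); apply/eqP/setP => e.
  have rE : (r * d) %/ d.+1.-1 = r by rewrite mulnK.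
  apply/imsetP/imsetP => -[i _ ->].
    have [m mr ->] := u_surj i; rewrite -rE in mr.
    by exists (Ordinal mr); rewrite // loose_edgeE.
  by exists (u i); rewrite // loose_edgeE.
- by apply/subsetP => _ /imsetP[i _ ->]; rewrite inE color.
apply/dinjectiveP => _ _ /imsetP[i _ ->] /imsetP[i' _ ->].
by rewrite !color => -[->].
Qed.

End HamiltonCycle.

(** * Estimates *)

From mathcomp Require Import all_classical all_reals all_analysis.
Import Order.TTheory GRing.Theory Num.Theory.
Import numFieldNormedType.Exports.

Section Threshold.
Variable R : realType.

Local Notation e := (expR 1 : R).

(** The ratio is [(1 + 1/m)^s], at most [exp(s/m)]. *)
Lemma expS_le_exp (m s : nat) : (s <= m)%N -> m.+1%:R ^+ s <= e * m%:R ^+ s.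
Proof.
case: m => [|m sm].
  by rewrite leqn0 => /eqP ->; rewrite !expr0; have := expR_ge1Dx (1 : R); lra.
have m0 : 0 < m.+1%:R :> R by [].
have -> : m.+2%:R = m.+1%:R * (1 + m.+1%:R^-1) :> R.
  by rewrite mulrDr mulr1 divff ?gt_eqF // -natr1.
rewrite exprMn mulrC ler_wpM2r ?exprn_ge0 //.
apply: (@le_trans _ _ (expR (m.+1%:R^-1 : R) ^+ s)).
  by rewrite lerXn2r ?nnegrE ?expR_ge0 ?expR_ge1Dx // addr_ge0 // invr_ge0.
by rewrite -expRM_natl ler_expR ler_pdivrMr // mul1r ler_nat.
Qed.

Lemma exp_fact_le (m s : nat) : (s <= m)%N ->
  (m - s)`!%:R * (m%:R / e) ^+ s <= m`!%:R.
Proof.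
rewrite expr_div_n mulrA ler_pdivrMr ?exprn_gt0 ?expR_gt0 //.
elim: m s => [|m IH] [|s] sm; rewrite ?subn0 ?expr0 ?mulr1 //.
rewrite subSS factS natrM (exprS e) exprS mulrCA -mulrA [leRHS]mulrCA.
rewrite [leRHS]mulrA.
apply: le_trans (_ : m.+1%:R * ((m - s)`!%:R * (e * m%:R ^+ s)) <= _).
  by rewrite !ler_wpM2l ?expS_le_exp.
rewrite -!mulrA [leRHS]mulrCA ler_wpM2l // [leLHS]mulrCA [leRHS]mulrCA.
by rewrite ler_wpM2l ?expR_ge0 ?IH.
Qed.

(** After multiplication by [r] this follows from [exp_fact_le]: the extra [2 ^ s] pays for the
    passage from [r] to [r.-1]. *)
Lemma exp_pred_fact_le (r s : nat) : (0 < r)%N -> (s <= r)%N ->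
  (r.-1 - s)`!%:R * (r%:R / (2%:R * e)) ^+ s <= r.-1`!%:R.
Proof.
move=> r0 sr.
(* For [s < r] this is [r <= (s + 1) * (r - s)] with [s + 1 <= 2 ^ s]; for [s = r] both subtractions
   give zero. *)
have H : (r * (r.-1 - s)`! <= 2 ^ s * (r - s)`!)%N.
  have s2 : (s < 2 ^ s)%N by rewrite ltn_expl.
  have [->|sr'] := eqVneq s r.
    have -> : (r.-1 - r = 0)%N by lia.
    by rewrite subnn !fact0 !muln1 ltnW // ltn_expl.
  have -> : (r - s = (r.-1 - s).+1)%N by lia.
  by rewrite factS mulnA leq_mul2r; apply/orP; right; nia.
have r0' : 0 < r%:R :> R by rewrite ltr0n.
rewrite -(ler_pM2l r0') -natrM.
have -> : (r * r.-1`! = r`!)%N by case: (r) r0 => // n _; rewrite factS.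
apply: le_trans (exp_fact_le sr).
have -> : r%:R / (2%:R * e) = 2%:R^-1 * (r%:R / e) by field; rewrite gt_eqF ?expR_gt0.
rewrite exprMn !mulrA ler_wpM2r //.
by rewrite exprVn ler_pdivrMr ?exprn_gt0 // -natrX -!natrM ler_nat [leqRHS]mulnC.
Qed.

(** * Spread and failure probability of the cycle family *)

Section Bound.
Variables (d r : nat) (p : R).
Hypotheses (d_gt1 : (1 < d)%N) (r_gt1 : (1 < r)%N) (p01 : 0 <= p <= 1).

(** One factor accounts for the successor map and [d] factors for the class permutations, so the
    order is [n^k] for fixed [k]. *)
Let kappa : R := (r%:R / (2%:R * e)) ^+ d.+1.

Lemma cycle_spread (S : {set ksubset d.+1 (r * d) * 'I_r}) :
  #|[set w in cycle_indices d r | S \subset cycle_member d_gt1 w]|%:R *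
    kappa ^+ #|S| <= #|cycle_indices d r|%:R.
Proof.
(* If some member contains [S], then [S] has at most [r] elements, as the factorial estimates
   require. *)
set X := finset _; have [->|[w]] := set_0Vmem X; first by rewrite cards0 mul0r.
rewrite inE => /andP[_ Sw]; have := cycle_indices_spread d_gt1 r_gt1 S.
rewrite -/X => le_X; have sr := leq_trans (subset_leq_card Sw) (card_cycle_member d_gt1 w).
set s := #|S| in le_X sr *.
have re0 : 0 <= r%:R / (2%:R * e) by rewrite divr_ge0 // mulr_ge0 // expR_ge0.
apply: le_trans (_ : (r.-1`! * r`! ^ d)%:R <= _); last first.
  by rewrite ler_nat card_cycle_indices_ge.
apply: le_trans (_ : ((r.-1 - s)`! * (2 ^ s * (r - s)`!) ^ d)%:R * kappa ^+ s <= _).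
  by rewrite ler_wpM2r ?exprn_ge0 // ler_nat.
rewrite /kappa -exprM [(d.+1 * s)%N]mulnC exprM exprS [in leLHS]natrM [in leLHS]natrX.
rewrite [in leRHS]natrM [in leRHS]natrX mulrACA -exprMn.
apply: ler_pM; rewrite ?mulr_ge0 ?exprn_ge0 ?mulr_ge0 ?exprn_ge0 //.
  by apply: exp_pred_fact_le => //; apply: ltnW.
rewrite lerXn2r ?nnegrE ?mulr_ge0 ?exprn_ge0 //.
have -> : (2 ^ s * (r - s)`!)%:R * (r%:R / (2%:R * e)) ^+ s =
    (r - s)`!%:R * (r%:R / e) ^+ s.
  rewrite natrM natrX [2%:R ^+ s * _]mulrC -mulrA -exprMn; congr (_ * _ ^+ s).
  by field; rewrite gt_eqF // expR_gt0.
exact: exp_fact_le.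
Qed.

(** The least number with [r < 2 ^ rounds]; [lam] below is the product [q * kappa] for one of that
    many equal rounds. *)
Let rounds := (trunc_log 2 r).+1.
Let lam : R := p / r%:R / rounds%:R * kappa.

Let probE (H : colored_hypergraph d.+1 (r * d) r) :
  hypergraph_prob p H = prod_law (color_law (p / r%:R)) H.
Proof.
apply: eq_bigr => x _; case: (H x) => //=.
by rewrite card_ord divfK // pnatr_eq0 -lt0n ltnW.
Qed.

Let p_div_ge0 : 0 <= p / r%:R.
Proof. by case/andP: p01 => p0 _; rewrite divr_ge0. Qed.

Let p_div_le1 : p / r%:R * #|'I_r|%:R <= 1.
Proof.
case/andP: p01 => _ p1.
by rewrite card_ord divfK // pnatr_eq0 -lt0n ltnW.
Qed.

Let prob_ge0 (H : colored_hypergraph d.+1 (r * d) r) : 0 <= hypergraph_prob p H.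
Proof. by rewrite probE prod_law_ge0 // => o; apply: color_law_ge0. Qed.

Let sum_prob : \sum_(H : colored_hypergraph d.+1 (r * d) r) hypergraph_prob p H = 1.
Proof.
rewrite (eq_bigr _ (fun H _ => probE H)) sum_prod_law //.
exact: sum_color_law.
Qed.

Lemma rainbow_cycle_prob : 8%:R <= lam ->
  `|1 - Pr p (@has_rainbow_loose_Hamilton_cycle d.+1 (r * d) r)| <= 8%:R / lam.
Proof.
move=> lam8; set hasC := @has_rainbow_loose_Hamilton_cycle _ _ _.
have lam0 : 0 < lam by apply: lt_le_trans lam8.
pose J := cycle_indices d r; pose A := @cycle_member d r d_gt1.
have J0 : 0 < #|J|%:R :> R.
  rewrite ltr0n (leq_trans _ (card_cycle_indices_ge d_gt1 r_gt1)) //.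
  by rewrite muln_gt0 expn_gt0 !fact_gt0.
have fail_le : fail_prob (p / r%:R) J A <= 8%:R / lam.
  have rE : p / r%:R / rounds%:R * rounds%:R = p / r%:R.
    by rewrite divfK // pnatr_eq0.
  have kappa0 : 0 <= kappa.
    by rewrite exprn_ge0 // divr_ge0 // mulr_ge0 // expR_ge0.
  have : #|J|%:R * fail_prob (p / r%:R) J A <=
      #|J|%:R * (4%:R / lam) * (2%:R - 2%:R / 2%:R ^+ rounds).
    rewrite -[X in fail_prob X]rE; apply: spread_fail_prob => //.
    - by rewrite divr_ge0.
    - by rewrite rE; exact: p_div_le1.
    - by move=> w _; apply: cycle_member_fst_inj.
    - move=> w _; apply: leq_ltn_trans (card_cycle_member _ _) _.
      exact: trunc_log_ltn.
    - exact: cycle_spread.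
  rewrite -mulrA ler_pM2l // => H; apply: le_trans H _.
  have -> : 8%:R / lam = 4%:R / lam * 2%:R by field; rewrite gt_eqF.
  rewrite ler_wpM2l ?divr_ge0 ?(ltW lam0) //.
  by rewrite gerBl divr_ge0 // exprn_ge0.
have PrE : 1 - Pr p hasC = \sum_(H | ~~ hasC H) hypergraph_prob p H.
  by rewrite -sum_prob (bigID hasC) /= /Pr addrC addrK.
rewrite PrE ger0_norm ?sumr_ge0 //; apply: le_trans fail_le.
rewrite big_mkcond; apply: ler_sum => H _; rewrite probE.
have [hasH|nhasH] := boolP (hasC H).
  by rewrite mulr_ge0 // -probE.
case hitH: (hits J A (graph H)); last by rewrite mulr1.
case/exists_inP: hitH => w wJ wH.
by case/negP: nhasH; apply: cycle_member_rainbow wH.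
Qed.

(** The number of rounds is at most [ln n / ln 2], because [2 ^ rounds <= 2 * r <= n]. This cancels
    the logarithm in the bound on [p], and the powers of [r] cancel as well. *)
Lemma rounds_lower_bound (omega : R) : 0 <= omega ->
  omega * ln (r * d)%:R / (r * d)%:R ^+ d <= p ->
  omega * (ln 2%:R / (d%:R ^+ d * (2%:R * e) ^+ d.+1)) <= lam.
Proof.
move=> omega0 p_ge.
have r0 : 0 < r%:R :> R by rewrite ltr0n ltnW.
have d0 : 0 < d%:R :> R by rewrite ltr0n ltnW.
have e0 : 0 < 2%:R * e by rewrite mulr_gt0 // expR_gt0.
have m0 : 0 < rounds%:R :> R by rewrite ltr0n.
have lnE : rounds%:R * ln 2%:R <= ln (r * d)%:R :> R.
  rewrite mulrC mulr_natr -lnXn // ler_ln ?posrE ?exprn_gt0 ?ltr0n ?muln_gt0 //; last first.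
    by rewrite (ltnW r_gt1) (ltnW d_gt1).
  by rewrite -natrX ler_nat /rounds expnS mulnC leq_mul // trunc_logP // ltnW.
have lamE : lam = p * (r%:R ^+ d / (2%:R * e) ^+ d.+1 / rounds%:R).
  rewrite /lam /kappa expr_div_n exprS.
  by field; rewrite !gt_eqF //= ?exprn_gt0.
rewrite lamE; apply: le_trans (ler_wpM2r _ p_ge); last first.
  by rewrite !divr_ge0 // ?exprn_ge0 // ltW.
rewrite natrM [(r%:R * d%:R) ^+ d]exprMn.
have -> : omega * ln (r%:R * d%:R) / (r%:R ^+ d * d%:R ^+ d) *
   (r%:R ^+ d / (2%:R * e) ^+ d.+1 / rounds%:R) =
   omega * (ln (r%:R * d%:R) / rounds%:R / (d%:R ^+ d * (2%:R * e) ^+ d.+1)).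
  by field; rewrite !gt_eqF //= ?exprn_gt0.
rewrite ler_wpM2l // ler_wpM2r ?invr_ge0 ?mulr_ge0 ?exprn_ge0 ?(ltW e0) //.
by rewrite ler_pdivlMr // mulrC -natrM.
Qed.

End Bound.
End Threshold.

(** * Convergence of the probability to one *)

Local Open Scope classical_set_scope.

Theorem theorem6 (R : realType) (k : nat) (hk : (3 <= k)%N)
    (omega p : nat -> R)
    (homega : omega n @[n --> within (positive_multiples k.-1) \oo] --> +oo)
    (hp01 : forall n, positive_multiples k.-1 n -> 0 <= p n <= 1)
    (hp : forall n, positive_multiples k.-1 n ->
       omega n * ln n%:R / n%:R ^+ k.-1 <= p n) :
  Pr (p n) (@has_rainbow_loose_Hamilton_cycle k n (n %/ k.-1)%N)
    @[n --> within (positive_multiples k.-1) \oo] --> (1 : R).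
Proof.
case: k hk homega hp01 hp => // d; rewrite ltnS /= => d_gt1 homega hp01 hp.
pose c : R := ln 2%:R / (d%:R ^+ d * (2%:R * expR 1) ^+ d.+1).
have c0 : 0 < c.
  have d0 : (0 < d)%N by apply: ltnW.
  apply: divr_gt0; first by rewrite ln_gt0 // ltr1n.
  by apply: mulr_gt0; apply: exprn_gt0; rewrite ?mulr_gt0 ?expR_gt0 ?ltr0n.
apply/cvgrPdist_le => eps eps0.
have eps8 : 0 < 8%:R / eps by rewrite divr_gt0.
near=> n.
have : positive_multiples d n.
  by near: n; rewrite near_withinE; near=> n.
(* This provides at least two edges, as the construction of the cycles requires. *)
have n_ge : (2 * d <= n)%N.
  near: n; rewrite near_withinE; near=> n => _; near: n.
  exact: nbhs_infty_ge.
(* The first summand secures [8 <= lam], the second makes the error [8 / lam] at most [eps]. *)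
have omega_ge : (8%:R + 8%:R / eps) / c <= omega n.
  by near: n; exact: cvgry_ge.
move=> /[dup] Dn [_ /dvdnP[r nE]].
have r_gt1 : (1 < r)%N by move: n_ge; rewrite nE leq_pmul2r // ltnW.
have := hp n Dn; have := hp01 n Dn; move: omega_ge.
have d_gt0 := ltnW d_gt1; rewrite nE mulnK // => omega_ge p01 p_ge.
have omega0 : 0 <= omega (r * d)%N.
  by apply: le_trans omega_ge; rewrite divr_ge0 ?addr_ge0 ?ltW.
have := rounds_lower_bound d_gt1 r_gt1 omega0 p_ge; rewrite -/c.
set lam := (X in _ <= X) => lam_ge.
have lam_ge8 : 8%:R + 8%:R / eps <= lam.
  by apply: le_trans lam_ge; rewrite -ler_pdivrMr.
have lam8 : 8%:R <= lam by lra.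
apply: le_trans (rainbow_cycle_prob d_gt1 r_gt1 p01 lam8) _; rewrite -/lam.
rewrite ler_pdivrMr; last by apply: lt_le_trans lam8.
rewrite -ler_pdivrMl // [leLHS]mulrC; apply: le_trans lam_ge8.
by rewrite lerDr.
Unshelve. all: by end_near.
Qed.
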